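(* Let $f:\mathbf{R}^N\to\mathbf{R}$ be partially separable of degree $\omega$ with block Lipschitz gradient with constants $L=(L_1,\dots,L_n)$. Let $\hat S$ be a proper uniform sampling and let $\nu=(\nu_1,\dots,\nu_n)$ with $\nu_i=\mathbf{E}[\min\{\omega,|\hat S|\}\mid i\in\hat S]$. Then $$(f,\hat S)\sim ESO(1,\nu\odot L).$$ If, in addition, $\mathbf{P}(|\hat S|=\tau)=1$ for some $\tau$, then $$(f,\hat S)\sim ESO(\min\{\omega,\tau\},L).$$ Moreover, this last ESO is monotonic: for every proper closed convex block separable $\Omega:\mathbf{R}^N\to\mathbf{R}\cup\{+\infty\}$, with $F=f+\Omega$, $\beta=\min\{\omega,\tau\}$ and $w=L$, one has $F(x+(h(x))_{[\hat S]})\le F(x)$ with probability 1 for all $x\in\operatorname{dom}F$.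
   Context: Blocks: $[n]=\{1,\dots,n\}$; $N=N_1+\dots+N_n$ with $N_i\ge1$; $U=[U_1,\dots,U_n]$ is a column permutation of the $N\times N$ identity matrix, with $U_i$ of size $N\times N_i$. For $x\in\mathbf{R}^N$, the $i$-th block is $x^{(i)}=U_i^Tx\in\mathbf{R}^{N_i}$, and for $S\subseteq[n]$, $x_{[S]}=\sum_{i\in S}U_ix^{(i)}$. $\langle\cdot,\cdot\rangle$ is the Euclidean inner product. For fixed symmetric positive definite matrices $B_i\in\mathbf{R}^{N_i\times N_i}$, $\|t\|_{(i)}=\langle B_it,t\rangle^{1/2}$ and $\|t\|_{(i)}^*=\langle B_i^{-1}t,t\rangle^{1/2}$. For $w\in\mathbf{R}^n_{++}$ (positive entries), $\|x\|_w=(\sum_{i=1}^nw_i\|x^{(i)}\|_{(i)}^2)^{1/2}$. For $w,z\in\mathbf{R}^n$, $w\odot z=(w_1z_1,\dots,w_nz_n)$. Partially separable of degree $\omega$ ($\omega$ an integer, $1\le\omega\le n$): $f=\sum_{J\in\mathcal{J}}f_J$, where $\mathcal{J}$ is a finite (nonempty) collection, possibly with repetitions, of nonempty subsets of $[n]$ with $|J|\le\omega$ for all $J\in\mathcal{J}$, and each $f_J:\mathbf{R}^N\to\mathbf{R}$ is convex, differentiable and depends on the blocks $x^{(i)}$, $i\in J$, only. Block Lipschitz gradient with constants $L_1,\dots,L_n>0$: $\|U_i^T\nabla f(x+U_it)-U_i^T\nabla f(x)\|_{(i)}^*\le L_i\|t\|_{(i)}$ for all $x\in\mathbf{R}^N$,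 $i\in[n]$, $t\in\mathbf{R}^{N_i}$. A sampling $\hat S$ is a random subset of $[n]$. It is proper if $\mathbf{P}(i\in\hat S)>0$ for all $i$, and uniform if $\mathbf{P}(i\in\hat S)$ does not depend on $i$. ESO: for $\beta>0$, $w\in\mathbf{R}^n_{++}$ and a proper uniform sampling $\hat S$, $(f,\hat S)\sim ESO(\beta,w)$ means that for all $x,h\in\mathbf{R}^N$, $$\mathbf{E}[f(x+h_{[\hat S]})]\le f(x)+\tfrac{\mathbf{E}[|\hat S|]}{n}\left(\langle\nabla f(x),h\rangle+\tfrac\beta2\|h\|_w^2\right).$$ Block separable: $\Omega(x)=\sum_{i=1}^n\Omega_i(x^{(i)})$ with $\Omega_i:\mathbf{R}^{N_i}\to\mathbf{R}\cup\{+\infty\}$ closed and convex. $\operatorname{dom}F=\{x:F(x)<+\infty\}$. $h(x)=\arg\min_{h\in\mathbf{R}^N}\{f(x)+\langle\nabla f(x),h\rangle+\frac\beta2\|h\|_w^2+\Omega(x+h)\}$. *)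

(* Defs.v *)
From HB Require Import structures.
From mathcomp Require Import all_boot all_order all_fingroup all_algebra.
From mathcomp Require Import all_classical all_reals all_analysis.

Set Implicit Arguments.
Unset Strict Implicit.
Unset Printing Implicit Defensive.

Import Order.TTheory GRing.Theory Num.Theory.
Import numFieldNormedType.Exports.

Local Open Scope classical_set_scope.
Local Open Scope ring_scope.

Section Vectors.
Context {R : realType}.

Definition inner (m : nat) (u v : 'cV[R]_m) : R := \sum_k u k 0 * v k 0.

Definition sym_posdef (m : nat) (B : 'M[R]_m) : Prop :=
  B^T = B /\ forall t : 'cV[R]_m, t != 0 -> 0 < inner (B *m t) t.

(* [mxnorm B] is the norm ||.||_(i) for B = B_i, and [mxnorm (invmx B)] is the
   dual norm ||.||_(i)^*. *)
Definition mxnorm (m : nat) (B : 'M[R]_m) (t : 'cV[R]_m) : R :=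
  Num.sqrt (inner (B *m t) t).

(* The vector of partial derivatives; it is the gradient wherever [f] is
   differentiable. *)
Definition grad (m : nat) (f : 'cV[R]_m -> R) (x : 'cV[R]_m) : 'cV[R]_m :=
  \col_k 'D_(delta_mx k 0) f x.

End Vectors.

Section ExtendedFunctions.
Context {R : realType} {m : nat}.
Local Open Scope ereal_scope.

(* Values in R U {+oo}, not identically +oo. *)
Definition proper_fun (g : 'cV[R]_m -> \bar R) : Prop :=
  (forall x, g x != -oo) /\ exists x, g x < +oo.

Definition closed_fun (g : 'cV[R]_m -> \bar R) : Prop :=
  closed [set p : 'cV[R]_m * R | g p.1 <= p.2%:E].

(* Meant for functions that never take the value -oo; recall 0 * +oo = 0. *)
Definition convex_efun (g : 'cV[R]_m -> \bar R) : Prop :=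
  forall (x y : 'cV[R]_m) (t : R), (0 <= t <= 1)%R ->
    g (t *: x + (1 - t) *: y)%R <= t%:E * g x + (1 - t)%:E * g y.

Definition dom (g : 'cV[R]_m -> \bar R) : set 'cV[R]_m :=
  [set x | g x < +oo].

Definition argmin (g : 'cV[R]_m -> \bar R) : set 'cV[R]_m :=
  [set h | forall h', g h <= g h'].

End ExtendedFunctions.

(* Blocks are indexed by 'I_n and N = \sum_i Ns i.  The permutation [s]
   determines U, a column permutation of the identity matrix, which is cut into
   U = [U_1, ..., U_n]. *)
Section Blocks.
Context {R : realType} {n : nat} {Ns : 'I_n -> nat}.
Local Notation N := (\sum_i Ns i)%N.
Variable s : 'S_N.

Definition U_ (i : 'I_n) : 'M[R]_(N, Ns i) := submxrow (col_perm s 1%:M) i.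

Definition block (i : 'I_n) (x : 'cV[R]_N) : 'cV[R]_(Ns i) := (U_ i)^T *m x.

(* x_[S] *)
Definition restr (S : {set 'I_n}) (x : 'cV[R]_N) : 'cV[R]_N :=
  \sum_(i in S) U_ i *m block i x.

Definition wnorm (B : forall i, 'M[R]_(Ns i)) (w : 'I_n -> R) (x : 'cV[R]_N)
    : R :=
  Num.sqrt (\sum_i w i * mxnorm (B i) (block i x) ^+ 2).

Definition depends_on (J : {set 'I_n}) (g : 'cV[R]_N -> R) : Prop :=
  forall x y, (forall i, i \in J -> block i x = block i y) -> g x = g y.

(* The collection of sets J is a nonempty finite family, so that repetitions
   are allowed. *)
Definition partially_separable (omega : nat) (f : 'cV[R]_N -> R) : Prop :=
  exists (m : nat) (J : 'I_m.+1 -> {set 'I_n}) (fJ : 'I_m.+1 -> 'cV[R]_N -> R),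
    [/\ forall k, J k != finset.set0 /\ (#|J k| <= omega)%N,
        forall k, convex_function [set: 'cV[R]_N] (fJ k),
        forall k x, differentiable (fJ k) x,
        forall k, depends_on (J k) (fJ k)
      & forall x, f x = \sum_k fJ k x].

Definition block_lipschitz (B : forall i, 'M[R]_(Ns i)) (f : 'cV[R]_N -> R)
    (L : 'I_n -> R) : Prop :=
  forall (x : 'cV[R]_N) (i : 'I_n) (t : 'cV[R]_(Ns i)),
    mxnorm (invmx (B i))
      ((U_ i)^T *m grad f (x + U_ i *m t) - (U_ i)^T *m grad f x)
    <= L i * mxnorm (B i) t.

Definition block_separable (Om : 'cV[R]_N -> \bar R) : Prop :=
  exists Omi : forall i, 'cV[R]_(Ns i) -> \bar R,
    [/\ forall i t, Omi i t != -oo%E,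
        forall i, closed_fun (Omi i),
        forall i, convex_efun (Omi i)
      & forall x, Om x = (\sum_i Omi i (block i x))%E].

End Blocks.

Section Samplings.
Context {R : realType} {d : measure_display} {T : measurableType d}.
Variable P : probability T R.

Definition cond_expectation (A : set T) (X : T -> R) : R :=
  fine 'E_P[X \* \1_A] / fine (P A).

Context {n : nat}.
Variable S : T -> {set 'I_n}.

Definition sampling : Prop := forall A : {set 'I_n}, measurable (S @^-1` [set A]).

Definition contains (i : 'I_n) : set T := [set t | i \in S t].

Definition proper_sampling : Prop := forall i, (0 < P (contains i))%E.

Definition uniform_sampling : Prop :=
  forall i j, P (contains i) = P (contains j).

Definition nu (omega : nat) (i : 'I_n) : R :=
  cond_expectation (contains i) (fun t => (minn omega #|S t|)%:R).

Context {Ns : 'I_n -> nat}.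
Local Notation N := (\sum_i Ns i)%N.
Variables (s : 'S_N) (B : forall i, 'M[R]_(Ns i)) (f : 'cV[R]_N -> R).

Definition ESO (beta : R) (w : 'I_n -> R) : Prop :=
  [/\ 0 < beta,
      forall i, 0 < w i
    & forall x h : 'cV[R]_N,
        ('E_P[fun t => f (x + restr s (S t) h)] <=
         (f x + fine 'E_P[fun t => #|S t|%:R] / n%:R *
            (inner (grad f x) h + beta / 2 * wnorm s B w h ^+ 2))%:E)%E].

Definition step_objective (Om : 'cV[R]_N -> \bar R) (beta : R) (w : 'I_n -> R)
    (x h : 'cV[R]_N) : \bar R :=
  ((f x + inner (grad f x) h + beta / 2 * wnorm s B w h ^+ 2)%:E
   + Om (x + h)%R)%E.

(* The minimizer h(x) is required to exist and to be unique: argmin = {h}. *)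
Definition monotonic (beta : R) (w : 'I_n -> R) : Prop :=
  forall Om : 'cV[R]_N -> \bar R,
    proper_fun Om -> closed_fun Om -> convex_efun Om -> block_separable s Om ->
    let F := fun x => ((f x)%:E + Om x)%E in
    forall x, dom F x ->
      exists h : 'cV[R]_N,
        argmin (step_objective Om beta w x) = [set h] /\
        \forall t \ae P, (F (x + restr s (S t) h)%R <= F x)%E.

End Samplings.

(* Main.v *)
(** Fix a realisation [A] of the sampling and put [theta := min (omega, #|A|)].
    Every summand [f_J] sees at most [theta] of the blocks of [h_[A]], so
    Jensen's inequality with weights [1 / theta] bounds its increment along
    [h_[A]] by the average of its increments along the blocks [theta h^(i)],
    [i] in [A]; summing over [J] and using the descent inequality of each block
    gives the deterministic bound
      [f (x + h_[A]) <= f x +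
        \sum_(i in A) (<grad_i f x, h^(i)> + theta / 2 * L_i ||h^(i)||^2)].
    Its expectation is the first ESO, and the second is the case of constant
    [theta].  For monotonicity, the minimiser [h] of the strongly convex step
    objective is compared with [h_[~: A]]: block separability shows that moving
    the blocks in [A] alone does not increase the objective either, while the
    deterministic bound says that the objective at [h_[A]] dominates [F]. *)

Require Import Defs.
From HB Require Import structures.
From mathcomp Require Import all_boot all_order all_fingroup all_algebra.
From mathcomp Require Import all_classical all_reals all_analysis.
From mathcomp Require Import ring lra.

Set Implicit Arguments.
Unset Strict Implicit.
Unset Printing Implicit Defensive.

Import Order.TTheory GRing.Theory Num.Theory.
Import numFieldNormedType.Exports.

Local Open Scope classical_set_scope.
Local Open Scope ring_scope.

(** * Euclidean inner product and the norms of positive definite matrices *)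

Section Inner.
Context {R : realType} {m : nat}.
Implicit Types (u v w : 'cV[R]_m) (B : 'M[R]_m).

Lemma innerC u v : inner u v = inner v u.
Proof. by apply: eq_bigr => k _; rewrite mulrC. Qed.

Lemma innerE u v : inner u v = (u^T *m v) 0 0.
Proof. by rewrite mxE; apply: eq_bigr => k _; rewrite mxE. Qed.

Lemma innerDr u v w : inner u (v + w) = inner u v + inner u w.
Proof. by rewrite !innerE mulmxDr mxE. Qed.

Lemma innerZr u a v : inner u (a *: v) = a * inner u v.
Proof. by rewrite !innerE -scalemxAr mxE. Qed.

Lemma inner0r u : inner u 0 = 0.
Proof. by rewrite !innerE mulmx0 mxE. Qed.

Lemma innerNr u v : inner u (- v) = - inner u v.
Proof. by rewrite -scaleN1r innerZr mulN1r. Qed.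

Lemma innerDl u v w : inner (u + v) w = inner u w + inner v w.
Proof. by rewrite innerC innerDr !(innerC w). Qed.

Lemma innerNl u v : inner (- u) v = - inner u v.
Proof. by rewrite innerC innerNr innerC. Qed.

Lemma innerZl u a v : inner (a *: u) v = a * inner u v.
Proof. by rewrite innerC innerZr innerC. Qed.

Lemma inner_sumr (I : finType) (A : pred I) u (F : I -> 'cV[R]_m) :
  inner u (\sum_(i | A i) F i) = \sum_(i | A i) inner u (F i).
Proof.
elim/big_rec2: _ => [|i y z _ <-]; first exact: inner0r.
by rewrite innerDr.
Qed.

Lemma mxnormZ B a u : mxnorm B (a *: u) = `|a| * mxnorm B u.
Proof.
rewrite /mxnorm -scalemxAr innerZl innerZr mulrA -expr2.
by rewrite sqrtrM ?sqr_ge0// sqrtr_sqr.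
Qed.

Variable B : 'M[R]_m.
Hypothesis Bpd : sym_posdef B.

Lemma posdef_ge0 u : 0 <= inner (B *m u) u.
Proof.
have [->|u0] := eqVneq u 0; first by rewrite inner0r.
exact/ltW/(Bpd.2 _ u0).
Qed.

Lemma mxnorm_sqr u : mxnorm B u ^+ 2 = inner (B *m u) u.
Proof. by rewrite sqr_sqrtr// posdef_ge0. Qed.

Lemma mxnorm_eq0 u : mxnorm B u = 0 -> u = 0.
Proof.
move=> u0; apply/eqP; apply: contraT => /(Bpd.2 _).
by rewrite -mxnorm_sqr u0 expr0n ltxx.
Qed.

Lemma posdef_innerC u v : inner (B *m u) v = inner (B *m v) u.
Proof.
by rewrite innerC [RHS]innerE trmx_mul (Bpd.1) -mulmxA innerE.
Qed.

Lemma posdef_unitmx : B \in unitmx.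
Proof.
rewrite unitmxE unitfE; apply/negP => /det0P[v v0 vB].
have vT0 : v^T != 0 by rewrite trmx_eq0.
have := Bpd.2 _ vT0.
have -> : B *m v^T = 0 by rewrite -[B](Bpd.1) -trmx_mul vB trmx0.
by rewrite innerC inner0r ltxx.
Qed.

(** With [a] and [b] the two norms, expanding the squared norm of [b *: u - a *: v] gives [2 * a * b
    * (a * b - inner (B *m u) v) >= 0]. The cases [a = 0] and [b = 0] are split off so that [a * b]
    can be cancelled. *)
Lemma posdef_cauchy_schwarz u v :
  inner (B *m u) v <= mxnorm B u * mxnorm B v.
Proof.
set a := mxnorm B u; set b := mxnorm B v.
have a0 : 0 <= a by exact: sqrtr_ge0.
have b0 : 0 <= b by exact: sqrtr_ge0.
have [a_0|an0] := eqVneq a 0.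
  by rewrite a_0 (mxnorm_eq0 a_0) mulmx0 innerC inner0r mul0r.
have [b_0|bn0] := eqVneq b 0.
  by rewrite b_0 (mxnorm_eq0 b_0) inner0r mulr0.
have ab0 : 0 < a * b by rewrite mulr_gt0// lt_neqAle eq_sym ?an0 ?bn0.
have := posdef_ge0 (b *: u - a *: v).
rewrite mulmxBr !innerDl !innerDr !innerNl !innerNr -!scalemxAr.
rewrite !innerZl !innerZr -!mxnorm_sqr -/a -/b (posdef_innerC v u).
set c := inner _ _ => h.
rewrite -(ler_pM2l ab0); lra.
Qed.

(** Cauchy-Schwarz for [B] applied to [invmx B *m u], whose [B]-norm is the dual norm of [u]. *)
Lemma inner_le_dual_norm u v :
  inner u v <= mxnorm (invmx B) u * mxnorm B v.
Proof.
have Bu := posdef_unitmx.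
have -> : mxnorm (invmx B) u = mxnorm B (invmx B *m u).
  by rewrite /mxnorm mulmxA mulmxV// mul1mx innerC.
by rewrite -[u in inner u]mul1mx -(mulmxV Bu) -mulmxA posdef_cauchy_schwarz.
Qed.

End Inner.

(** * Orthogonal decomposition of vectors into blocks *)

Section Blocks.
Context {R : realType} {n : nat} {Ns : 'I_n -> nat}.
Local Notation N := (\sum_i Ns i)%N.
Variable s : 'S_N.
Implicit Types (x h : 'cV[R]_N) (A : {set 'I_n}).
Local Notation U := (@U_ R n Ns s).

(** Column [a] of [U i] is column [tagnat.Rank i a] of the permuted identity, and the columns of a
    permutation matrix are orthonormal. *)
Lemma UTU_E i j a b :
  ((U i)^T *m U j) a b = (tagnat.Rank i a == tagnat.Rank j b :> nat)%:R.
Proof.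
rewrite mxE (bigD1 (s (tagnat.Rank i a)))//= [X in _ + X]big1 ?addr0.
  by rewrite !mxE eqxx mul1r (inj_eq perm_inj).
by move=> k /negbTE ka; rewrite !mxE ka mul0r.
Qed.

Lemma block_U i t : block s i (U i *m t) = t.
Proof.
rewrite /block mulmxA -[RHS]mul1mx; congr (_ *m _); apply/matrixP => a b.
by rewrite UTU_E mxE tagnat.eq_Rank eqxx.
Qed.

Lemma block_U_neq i j t : i != j -> block s i (U j *m t) = 0.
Proof.
move=> /negbTE ij; rewrite /block mulmxA -[RHS](mul0mx _ t); congr (_ *m _).
by apply/matrixP => a b; rewrite UTU_E mxE tagnat.eq_Rank ij.
Qed.

(** The sum of the [U i *m (U i)^T] is the block product of the whole permutation matrix with its
    transpose, hence the identity. *)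
Lemma sum_U_block x : \sum_i U i *m block s i x = x.
Proof.
transitivity ((\sum_i U i *m (U i)^T) *m x).
  by rewrite mulmx_suml; apply: eq_bigr => i _; rewrite mulmxA.
rewrite -[RHS]mul1mx; congr (_ *m _).
rewrite -mul_mxrow_mxcol -tr_mxrow submxrowK col_permE mul1mx.
by rewrite tr_perm_mx -perm_mxM invgK mulVg perm_mx1.
Qed.

Lemma block_inj x y : (forall i, block s i x = block s i y) -> x = y.
Proof.
move=> xy; rewrite -[x]sum_U_block -[y]sum_U_block.
by apply: eq_bigr => i _; rewrite xy.
Qed.

Lemma blockD i x y : block s i (x + y) = block s i x + block s i y.
Proof. exact: mulmxDr. Qed.

Lemma blockZ i a x : block s i (a *: x) = a *: block s i x.
Proof. by rewrite /block -scalemxAr. Qed.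

Lemma block0 i : block s i (0 : 'cV[R]_N) = 0.
Proof. exact: mulmx0. Qed.

Lemma block_restr A i h :
  block s i (restr s A h) = if i \in A then block s i h else 0.
Proof.
rewrite {1}/block mulmx_sumr; case: ifPn => iA.
  rewrite (bigD1 i)//= [X in _ + X]big1 ?addr0; first exact: block_U.
  by move=> j /andP[_ ji]; apply: block_U_neq; rewrite eq_sym.
by apply: big1 => j jA; apply: block_U_neq; apply: contraNneq iA => ->.
Qed.

Lemma inner_U u i t : inner u (U i *m t) = inner (block s i u) t.
Proof. by rewrite !innerE trmx_mul trmxK mulmxA. Qed.

Lemma inner_blocks u h :
  inner u h = \sum_i inner (block s i u) (block s i h).
Proof.
rewrite -[h in LHS]sum_U_block inner_sumr.
by apply: eq_bigr => i _; rewrite inner_U.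
Qed.

Lemma wnorm_sqr B w h : (forall i, 0 <= w i) ->
  wnorm s B w h ^+ 2 = \sum_i w i * mxnorm (B i) (block s i h) ^+ 2.
Proof.
by move=> w0; rewrite sqr_sqrtr// sumr_ge0// => i _; rewrite mulr_ge0// sqr_ge0.
Qed.

End Blocks.

(** * Jensen's inequality for scaled increments *)

Section Convexity.
Context {R : realType} {V : lmodType R}.

Lemma convex_functionE (f : V -> R) x y (t : R) :
  convex_function [set: V] f -> 0 <= t <= 1 ->
  f (t *: x + (1 - t) *: y) <= t * f x + (1 - t) * f y.
Proof.
move=> cf /andP[t0 t1].
by have := cf (Itv01 t0 t1) x y; rewrite !in_setT; exact.
Qed.

(* Jensen's inequality with weights [theta^-1]; the missing mass
   [1 - size r / theta] is put on the base point [x]. *)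
Lemma convex_scaled_increments (f : V -> R) (x : V) (I : Type) (r : seq I)
    (v : I -> V) (theta : R) :
  convex_function [set: V] f -> 0 < theta -> (size r)%:R <= theta ->
  f (x + theta^-1 *: (\sum_(i <- r) v i)) - f x <=
  theta^-1 * \sum_(i <- r) (f (x + v i) - f x).
Proof.
move=> cf; elim: r theta => [|i r IHr] theta theta0.
  by rewrite !big_nil scaler0 addr0 subrr mulr0.
rewrite /= !big_cons -natr1 => rtheta.
(* A single increment is treated apart: [theta - 1] may then vanish, and the induction step divides
   by it. *)
have [/nilP r0|rn0] := boolP (nilp r).
  rewrite r0 in rtheta *; rewrite !big_nil !addr0.
  have t1 : 0 <= theta^-1 <= 1.
    by rewrite invr_ge0 (ltW theta0)/= invf_le1//; rewrite /= add0r in rtheta.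
  have := convex_functionE (x + v i) x cf t1.
  rewrite scalerDr addrAC -scalerDl subrKC scale1r; lra.
have r1 : 1 <= (size r)%:R :> R by rewrite ler1n lt0n.
have theta1 : 0 < theta - 1 by lra.
have rt1 : (size r)%:R <= theta - 1 by lra.
have := IHr _ theta1 rt1.
set S := \sum_(j <- r) v j; set T := \sum_(j <- r) _ => {}IHr.
have t1 : 0 <= theta^-1 <= 1.
  by rewrite invr_ge0 (ltW theta0)/= invf_le1//; lra.
(* The target point mixes [x + v i], with weight [theta^-1], and the point of the induction
   hypothesis for [theta - 1]. *)
have := convex_functionE (x + v i) (x + (theta - 1)^-1 *: S) cf t1.
have -> : theta^-1 *: (x + v i) + (1 - theta^-1) *: (x + (theta - 1)^-1 *: S)
    = x + theta^-1 *: (v i + S).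
  rewrite !scalerDr addrACA -scalerDl subrKC scale1r scalerA.
  congr (_ + (_ + _ *: _)); field.
  by apply/andP; split; lra.
move=> h; rewrite lerBlDr; apply: (le_trans h).
have -> : 1 - theta^-1 = theta^-1 * (theta - 1) by field; lra.
have h2 : (theta - 1) * f (x + (theta - 1)^-1 *: S) <= T + (theta - 1) * f x.
  move: IHr; rewrite -(ler_pM2l theta1) mulrA mulfV ?mul1r; lra.
rewrite -mulrA -mulrDr -lerBlDl.
rewrite -(ler_pM2l theta0) mulrBr !mulrA mulfV ?gt_eqF// !mul1r.
lra.
Qed.

End Convexity.

(** * Gradients and the descent inequality along a segment *)

Section Gradient.
Context {R : realType} {m : nat}.

Lemma derive_inner_grad (f : 'cV[R]_m -> R) x v :
  differentiable f x -> 'D_v f x = inner (grad f x) v.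
Proof.
move=> df; rewrite deriveE// [v in LHS]matrix_sum_delta.
rewrite linear_sum /inner; apply: eq_bigr => k _.
by rewrite big_ord1 linearZ/= mxE deriveE// mulrC.
Qed.

Lemma is_derive_line (f : 'cV[R]_m -> R) (x v : 'cV[R]_m) (a : R) :
  (forall y, differentiable f y) ->
  is_derive a 1 (fun b => f (x + b *: v)) (inner (grad f (x + a *: v)) v).
Proof.
move=> df; rewrite -derive_inner_grad//.
have dE : (fun h : R => h^-1 *: (((fun b => f (x + b *: v)) \o shift a) (h *: 1)
      - f (x + a *: v))) =
    (fun h : R =>
      h^-1 *: ((f \o shift (x + a *: v)) (h *: v) - f (x + a *: v))).
  apply/funext => h /=; congr (_ *: (f _ - _)).
  by rewrite [h *: 1]mulr1 scalerDl addrCA.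
have := @diff_derivable _ _ _ f (x + a *: v) v (df _).
split; last by rewrite /derive dE.
by rewrite /derivable dE.
Qed.

(* The mean value theorem applied to
   [b |-> f (x + b v) - b <grad f x, v> - b^2 c / 2] on [0, 1]. *)
Lemma directional_descent (f : 'cV[R]_m -> R) (x v : 'cV[R]_m) (c : R) :
  (forall y, differentiable f y) ->
  (forall a, 0 <= a <= 1 ->
     inner (grad f (x + a *: v)) v - inner (grad f x) v <= a * c) ->
  f (x + v) <= f x + inner (grad f x) v + c / 2.
Proof.
move=> df lip.
pose g b := f (x + b *: v) - (b * inner (grad f x) v + b ^+ 2 * (c / 2)).
pose dg b := inner (grad f (x + b *: v)) v - (inner (grad f x) v + b * c).
have gd (b : R) : is_derive b 1 g (dg b).
  have qd : is_derive b 1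
      (fun b : R => b * inner (grad f x) v + b ^+ 2 * (c / 2))
      (inner (grad f x) v + b * c).
    set k := inner _ _.
    have -> : (fun b : R => b * k + b ^+ 2 * (c / 2)) =
        (k *: id + (c / 2) *: (id ^+ 2)).
      by apply/funext => a; rewrite mulrC [X in _ + X]mulrC.
    apply: is_derive_eq; rewrite /= expr1 -[k%:A]/(k * 1).
    by rewrite -[_ *: _]/(c / 2 * (2 * b * 1)); field.
  exact: is_deriveB (is_derive_line x v b df) qd.
have gc : {within `[0, 1], continuous g}.
  apply: derivable_within_continuous => b _; exact: ex_derive.
have [b] := @MVT R g dg 0 1 ltr01 (fun b _ => gd b) gc.
rewrite in_itv/= => /andP[b0 b1].
rewrite subr0 mulr1 /g /dg !scale0r !scale1r addr0.
(* The slope bound at the intermediate point makes [dg b] nonpositive, so [g 1 <= g 0]. *)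
have := lip b; rewrite (ltW b0) (ltW b1) => /(_ isT).
lra.
Qed.

End Gradient.

(** * The deterministic bound for a fixed set of blocks *)

Section Descent.
Context {R : realType} {n : nat} {Ns : 'I_n -> nat}.
Local Notation N := (\sum_i Ns i)%N.
Variables (s : 'S_N) (B : forall i, 'M[R]_(Ns i)) (f : 'cV[R]_N -> R).
Variables (omega : nat) (L : 'I_n -> R).
Hypothesis hB : forall i, sym_posdef (B i).
Hypothesis hf : partially_separable s omega f.
Hypothesis hL : block_lipschitz s B f L.
Implicit Types (x h : 'cV[R]_N) (A : {set 'I_n}).

Lemma partially_separable_differentiable x : differentiable f x.
Proof.
case: hf => m [J [fJ [_ _ dfJ _ fE]]].
have -> : f = \sum_k fJ k by apply/funext => y; rewrite fE fct_sumE.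
exact: differentiable_sum.
Qed.

(** The dual norm inequality and the block Lipschitz condition bound the change of slope at
    [x + a *: (U_ s i *m t)] by [a * (L i * mxnorm (B i) t ^+ 2)], which is what
    [directional_descent] asks for. *)
Lemma block_descent x i (t : 'cV[R]_(Ns i)) :
  f (x + U_ s i *m t) <=
  f x + inner (block s i (grad f x)) t + L i / 2 * mxnorm (B i) t ^+ 2.
Proof.
rewrite -inner_U mulrAC.
apply: directional_descent; first exact: partially_separable_differentiable.
move=> a /andP[a0 _]; rewrite !inner_U -innerNl -innerDl scalemxAr.
apply: (le_trans (inner_le_dual_norm (hB i) _ _)).
apply: (le_trans (ler_wpM2r (sqrtr_ge0 _) (hL x (a *: t)))).
by rewrite mxnormZ ger0_norm// !mulrA [L i * a]mulrC.
Qed.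

(** Brings [restr s A h] into the shape required by [convex_scaled_increments]. *)
Lemma restr_scaled_sum (theta : R) A h : theta != 0 ->
  restr s A h =
  theta^-1 *: \sum_(i <- enum A) U_ s i *m (theta *: block s i h).
Proof.
move=> theta0; rewrite big_enum scaler_sumr; apply: eq_bigr => i _.
by rewrite -scalemxAr scalerA mulVf// scale1r.
Qed.

Lemma separable_increment_le A x h (theta := minn omega #|A|) :
  (0 < theta)%N ->
  f (x + restr s A h) - f x <=
  theta%:R^-1 *
    \sum_(i in A) (f (x + U_ s i *m (theta%:R *: block s i h)) - f x).
Proof.
move=> theta0; case: hf => m [J [fJ [Jomega cfJ _ depJ fE]]].
have fB v : f (x + v) - f x = \sum_k (fJ k (x + v) - fJ k x).
  by rewrite !fE sumrB.
rewrite fB [X in _ * X](eq_bigr _ (fun i _ => fB _)).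
rewrite exchange_big mulr_sumr/=; apply: ler_sum => k _.
have thetaR0 : 0 < theta%:R :> R by rewrite ltr0n.
(* Only the blocks in [A :&: J k] are seen by [fJ k], and there are at most [theta] of them, as
   Jensen's inequality requires. *)
have -> : fJ k (x + restr s A h) = fJ k (x + restr s (A :&: J k) h).
  by apply: (depJ k) => i iJ; rewrite !blockD !block_restr inE iJ andbT.
rewrite (@restr_scaled_sum theta%:R) ?gt_eqF//.
apply: le_trans (convex_scaled_increments _ _ _ thetaR0 _) _ => //.
  rewrite ler_nat -cardE leq_min (leq_trans _ (Jomega k).2) ?subset_leq_card//.
  - exact: subsetIl.
  - exact: subsetIr.
rewrite big_enum ler_wpM2l ?invr_ge0 ?ler0n//.
(* Blocks of [A] outside [J k] do not change [fJ k], so their increments are zero. *)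
rewrite [leRHS](bigID (mem (J k)))/= [X in _ + X]big1 ?addr0.
  rewrite le_eqVlt (eq_bigl (fun i => (i \in A) && (i \in J k))) ?eqxx// => i.
  by rewrite inE.
move=> i /andP[_ iJ]; apply/eqP; rewrite subr_eq0; apply/eqP.
apply: (depJ k) => j jJ; rewrite blockD block_U_neq ?addr0//.
by apply: contraNneq iJ => <-.
Qed.

Lemma sampled_descent A x h :
  f (x + restr s A h) <=
  f x + \sum_(i in A) (inner (block s i (grad f x)) (block s i h) +
    (minn omega #|A|)%:R / 2 * (L i * mxnorm (B i) (block s i h) ^+ 2)).
Proof.
(* For empty [A] the value [theta = 0] has no inverse; both sides are then [f x]. *)
have [->|A0] := eqVneq A finset.set0.
  by rewrite /restr !big_set0 !addr0.
set theta := minn omega #|A|.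
have theta0 : (0 < theta)%N.
  rewrite leq_min card_gt0 A0 andbT.
  case: hf => m [J [_ [Jomega _ _ _ _]]].
  (* [omega] is positive because it bounds the size of the nonempty set [J ord0]. *)
  by apply: leq_trans (Jomega ord0).2; rewrite card_gt0 (Jomega ord0).1.
have thetaR0 : 0 < theta%:R :> R by rewrite ltr0n.
rewrite -lerBlDl; apply: (le_trans (separable_increment_le _ _ theta0)).
(* The scaled block yields [theta ^+ 2] in the quadratic term, and the weight [theta^-1] leaves one
   factor [theta]. *)
rewrite mulr_sumr; apply: ler_sum => i _; rewrite ler_pdivrMl// lerBlDl.
apply: (le_trans (block_descent _ _)).
rewrite innerZr mxnormZ exprMn real_normK ?num_real//.
by rewrite le_eqVlt; apply/orP; left; apply/eqP; ring.
Qed.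

End Descent.

(** * The law of the sampling and expectations as finite sums *)

Section SamplingExpectation.
Context {R : realType} {d : measure_display} {T : measurableType d}.
Context (P : probability T R) {n : nat} (S : T -> {set 'I_n}).
Hypothesis hS : sampling S.

(** The law of the sampling as a real function on finitely many subsets, so that integrals become
    finite sums. *)
Definition sampling_mass (A : {set 'I_n}) : R := fine (P (S @^-1` [set A])).
Local Notation p := sampling_mass.

Lemma sampling_mass_ge0 A : 0 <= p A.
Proof. exact: fine_ge0. Qed.

(** [Phi (S t)] is a finite combination of the indicators of the events that [S] equals [A],
    integrated term by term. *)
Lemma expectation_sampling (Phi : {set 'I_n} -> R) :
  'E_P[fun t => Phi (S t)]%E = (\sum_A Phi A * p A)%:E.
Proof.
pose X A t := ((Phi A)%:E * (\1_(S @^-1` [set A]) t)%:E)%E : \bar R.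
have XE t : (Phi (S t))%:E = (\sum_A X A t)%E.
  rewrite (bigD1 (S t))//= big1 ?adde0.
    by rewrite /X indicE mem_set// mule1.
  move=> A AS; rewrite /X indicE memNset ?mule0//= => SA.
  by rewrite SA eqxx in AS.
have iX A : P.-integrable [set: T] (fun t => (\1_(S @^-1` [set A]) t)%:E).
  exact: integrable_indic.
rewrite unlock (eq_integral _ _ (fun t _ => XE t)) integral_sum//; last first.
  by move=> A; exact: integrableZl.
rewrite -sumEFin; apply: eq_bigr => A _.
rewrite integralZl// integral_indic// setIT EFinM /sampling_mass fineK//.
exact: fin_num_measure.
Qed.

Lemma measurable_sampling_event (Q : pred {set 'I_n}) :
  measurable [set t | Q (S t)].
Proof.
have -> : [set t | Q (S t)] = \bigcup_(A in [set A | Q A]) S @^-1` [set A].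
  apply/seteqP; split => [t /= Qt|t [A QA] /= ->]//.
  by exists (S t).
by apply: fin_bigcup_measurable => //; exact: finite_finset.
Qed.

Lemma sampling_eventE (Q : pred {set 'I_n}) :
  P [set t | Q (S t)] = (\sum_(A | Q A) p A)%:E.
Proof.
rewrite -expectation_indic; last exact: measurable_sampling_event.
have -> : \1_[set t | Q (S t)] = (fun t => (Q (S t))%:R) :> (T -> R).
  by apply/funext => t; rewrite indicE /in_mem/= /in_set asboolb.
rewrite (expectation_sampling (fun A => (Q A)%:R)) [in RHS]big_mkcond/=.
by congr (_%:E); apply: eq_bigr => A _; case: (Q A); rewrite ?mul1r ?mul0r.
Qed.

Lemma sum_sampling_mass : \sum_A p A = 1.
Proof.
have := sampling_eventE xpredT.
rewrite (_ : [set t | _] = setT) ?probability_setT; last exact/seteqP.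
by case.
Qed.

Lemma contains_mass i :
  fine (P (contains S i)) = \sum_(A : {set 'I_n} | i \in A) p A.
Proof. by rewrite (sampling_eventE (fun A => i \in A)). Qed.

Lemma sum_mass_exchange (F : 'I_n -> {set 'I_n} -> R) :
  \sum_(A : {set 'I_n}) (\sum_(i in A) F i A) * p A =
  \sum_i \sum_(A : {set 'I_n} | i \in A) F i A * p A.
Proof.
under eq_bigr do rewrite mulr_suml.
by rewrite (exchange_big_dep xpredT).
Qed.

Hypothesis hproper : proper_sampling P S.

Lemma contains_mass_gt0 i : 0 < fine (P (contains S i)).
Proof.
rewrite fine_gt0// hproper/= ltey_eq fin_num_measure//.
exact: (measurable_sampling_event (fun A => i \in A)).
Qed.

(** Properness makes the denominator of the conditional expectation nonzero, so it can be
    cleared. *)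
Lemma nuE omega i : nu P S omega i * fine (P (contains S i)) =
  \sum_(A : {set 'I_n} | i \in A) (minn omega #|A|)%:R * p A.
Proof.
rewrite /nu /cond_expectation mulfVK ?gt_eqF ?contains_mass_gt0//.
have -> : (fun t => (minn omega #|S t|)%:R) \* \1_(contains S i) =
    (fun t => (minn omega #|S t|)%:R * (i \in S t)%:R) :> (T -> R).
  by apply/funext => t; rewrite /= indicE /in_mem/= /in_set asboolb.
rewrite (expectation_sampling (fun A => (minn omega #|A|)%:R * (i \in A)%:R))/=.
rewrite [in RHS]big_mkcond/=; apply: eq_bigr => A _.
by case: (i \in A); rewrite ?mulr1 ?mulr0 ?mul0r.
Qed.

(** Every [A] containing [i] has [minn omega #|A| >= 1], so the sum in [nuE] is at least the
    positive mass of [contains S i]. *)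
Lemma nu_gt0 omega i : (0 < omega)%N -> 0 < nu P S omega i.
Proof.
move=> omega0; rewrite -(pmulr_lgt0 _ (contains_mass_gt0 i)) nuE.
apply: (lt_le_trans (contains_mass_gt0 i)); rewrite contains_mass.
apply: ler_sum => A iA; rewrite ler_peMl ?sampling_mass_ge0//.
by rewrite ler1n leq_min omega0; apply/card_gt0P; exists i.
Qed.

Hypothesis hunif : uniform_sampling P S.

(** Double counting gives the sum of all inclusion probabilities, and these are equal by
    uniformity. *)
Lemma expectation_card i :
  fine 'E_P[fun t => #|S t|%:R]%E = n%:R * fine (P (contains S i)).
Proof.
rewrite (expectation_sampling (fun A => #|A|%:R))/=.
transitivity (\sum_(A : {set 'I_n}) (\sum_(i in A) 1) * p A).
  by apply: eq_bigr => A _; rewrite sumr_const.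
rewrite sum_mass_exchange -[n in n%:R]card_ord -sumr_const mulr_suml.
apply: eq_bigr => j _; rewrite mul1r (hunif i j) contains_mass.
by apply: eq_bigr => A _; rewrite mul1r.
Qed.

(** The sets of size [tau] already carry mass 1, so the other masses, being nonnegative, sum to zero
    and vanish. *)
Lemma mass_of_constant_card tau (A : {set 'I_n}) :
  P [set t | #|S t| = tau] = 1%E -> #|A| != tau -> p A = 0.
Proof.
have -> : [set t | #|S t| = tau] = [set t | #|S t| == tau].
  by apply/seteqP; split => t /= /eqP.
rewrite (sampling_eventE (fun A => #|A| == tau)) => -[p1] Atau.
have := sum_sampling_mass.
rewrite (bigID (fun A : {set 'I_n} => #|A| == tau))/= p1.
move/eqP; rewrite addrC -subr_eq0 addrK => /eqP.
move/psumr_eq0P => -> //= ? _; exact: sampling_mass_ge0.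
Qed.

Lemma nu_of_constant_card omega tau i :
  P [set t | #|S t| = tau] = 1%E -> nu P S omega i = (minn omega tau)%:R.
Proof.
move=> htau; apply: (mulIf (lt0r_neq0 (contains_mass_gt0 i))).
rewrite nuE contains_mass mulr_sumr; apply: eq_bigr => A _.
have [->//|Atau] := eqVneq #|A| tau.
by rewrite (mass_of_constant_card htau)// !mulr0.
Qed.

Lemma ae_of_constant_card tau :
  P [set t | #|S t| = tau] = 1%E -> \forall t \ae P, #|S t| = tau.
Proof.
have -> : [set t | #|S t| = tau] = [set t | #|S t| == tau].
  by apply/seteqP; split => t /= /eqP.
move=> p1; exists (~` [set t | #|S t| == tau]); split.
- exact/measurableC/(measurable_sampling_event (fun A => #|A| == tau)).
- rewrite probability_setC ?p1 ?subee//.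
  exact/(measurable_sampling_event (fun A => #|A| == tau)).
- by move=> t /= + /eqP.
Qed.

End SamplingExpectation.

(** * The two expected separable overapproximations *)

Section ESO.
Context {R : realType} {n : nat} {Ns : 'I_n -> nat}.
Local Notation N := (\sum_i Ns i)%N.
Context (s : 'S_N) (B : forall i, 'M[R]_(Ns i)) (f : 'cV[R]_N -> R).
Context (omega : nat) (L : 'I_n -> R).
Context {d : measure_display} {T : measurableType d} (P : probability T R).
Context (S : T -> {set 'I_n}).
Hypothesis hB : forall i, sym_posdef (B i).
Hypothesis homega : (1 <= omega <= n)%N.
Hypothesis hf : partially_separable s omega f.
Hypothesis hL0 : forall i, 0 < L i.
Hypothesis hL : block_lipschitz s B f L.
Hypothesis hS : sampling S.
Hypothesis hproper : proper_sampling P S.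
Hypothesis hunif : uniform_sampling P S.

Lemma ESO_nu : ESO P S s B f 1 (fun i => nu P S omega i * L i).
Proof.
have omega0 : (0 < omega)%N by case/andP: homega.
have n0 : (0 < n)%N by case/andP: homega => /leq_trans; apply.
have w0 i : 0 < nu P S omega i * L i by rewrite mulr_gt0 ?nu_gt0.
split=> // x h; rewrite wnorm_sqr; last by move=> i; exact/ltW.
rewrite (expectation_sampling P hS (fun A => f (x + restr s A h))) lee_fin.
pose i0 := Ordinal n0.
(* By uniformity the factor in front of the bracket is the common inclusion probability. *)
have -> : fine 'E_P[fun t => #|S t|%:R]%E / n%:R = fine (P (contains S i0)).
  rewrite (expectation_card hS hunif i0) mulrAC mulfV ?mul1r//.
  by rewrite pnatr_eq0 -lt0n.
set q := fine _.
have qE i : fine (P (contains S i)) = q by rewrite /q (hunif i0 i).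
pose g i := inner (block s i (grad f x)) (block s i h).
pose c i := L i * mxnorm (B i) (block s i h) ^+ 2.
apply: (@le_trans _ _ (\sum_(A : {set 'I_n}) (f x + \sum_(i in A)
    (g i + (minn omega #|A|)%:R / 2 * c i)) * sampling_mass P S A)).
  apply: ler_sum => A _; rewrite ler_wpM2r ?sampling_mass_ge0//.
  exact: (sampled_descent hB hf hL).
rewrite [leLHS](eq_bigr _ (fun A _ => mulrDl _ _ _)).
rewrite big_split/= -mulr_sumr (sum_sampling_mass P hS) mulr1 lerD2l.
(* Summing over blocks first, the two sides agree block by block: [nuE] turns the weighted sum of
   [minn omega #|A|] into [nu] times the inclusion probability. *)
rewrite sum_mass_exchange (inner_blocks s) !mulrDr !mulr_sumr -big_split/=.
apply: ler_sum => i _; rewrite le_eqVlt; apply/orP; left; apply/eqP.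
rewrite [LHS](eq_bigr _ (fun A _ => mulrDl _ _ _)).
rewrite big_split/= -mulr_sumr -contains_mass// qE [q * inner _ _]mulrC.
congr (_ + _); rewrite -(qE i).
transitivity (c i / 2 * (nu P S omega i * fine (P (contains S i)))).
  by rewrite nuE// mulr_sumr; apply: eq_bigr => A _; ring.
by rewrite /c; ring.
Qed.

Variable tau : nat.
Hypothesis htau : P [set t | #|S t| = tau] = 1%E.

(** This number is a value of [nu], which is positive by properness; [n > 0] supplies the index. *)
Lemma minn_tau_gt0 : 0 < (minn omega tau)%:R :> R.
Proof.
have omega0 : (0 < omega)%N by case/andP: homega.
have n0 : (0 < n)%N by case/andP: homega => /leq_trans; apply.
by rewrite -(nu_of_constant_card hS hproper omega (Ordinal n0) htau) nu_gt0.
Qed.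

(** For a constant cardinality [nu] is the constant [minn omega tau], which moves out of the weights
    of [ESO_nu] into the parameter [beta]. *)
Lemma ESO_minn : ESO P S s B f (minn omega tau)%:R L.
Proof.
split=> // [|x h]; first exact: minn_tau_gt0.
case: ESO_nu => _ w0 /(_ x h).
rewrite !wnorm_sqr//; [|by move=> i; exact/ltW..].
congr (_ <= (_ + _ * (_ + _))%:E)%E.
rewrite mul1r !mulr_sumr; apply: eq_bigr => i _.
by rewrite (nu_of_constant_card hS hproper omega i htau); ring.
Qed.

End ESO.

(** * Existence and uniqueness of minimisers *)

Section CompactMinimum.
Context {R : realType}.

(** The nonempty sublevel sets within [K] are a filter base; a cluster point, given by compactness,
    lies in each of them because they are closed. *)
Lemma compact_sublevel_min (X : topologicalType) (K : set X) (g : X -> \bar R) :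
  compact K -> K !=set0 -> (forall a : R, closed [set x | (g x <= a%:E)%E]) ->
  exists2 x, K x & forall y, K y -> (g x <= g y)%E.
Proof.
move=> cK [x0 Kx0] clg.
pose D := [set a : R | exists2 y, K y & (g y <= a%:E)%E].
have [D0|/set0P[a0 Da0]] := eqVneq D set0.
  exists x0 => // y Ky; case gy : (g y) => [r| |]; rewrite ?leey//.
    have : D r by exists y; rewrite ?gy.
    by rewrite D0.
  have : D 0 by exists y; rewrite ?gy ?leNye.
  by rewrite D0.
pose C (a : R) := K `&` [set x | (g x <= a%:E)%E].
have FC : ProperFilter (filter_from D C).
  apply: filter_from_proper; last by move=> a [y Ky gy]; exists y.
  apply: filter_from_filter; first by exists a0.
  move=> a b Da Db; exists (Num.min a b).
    by rewrite /Num.min; case: ifP.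
  move=> x [Kx /= gx]; split; split=> //=; apply: (le_trans gx);
    by rewrite lee_fin ge_min lexx ?orbT.
have [|x [Kx]] := cK _ FC; first by exists a0 => // x [].
rewrite clusterE => clx.
have gxD a : D a -> (g x <= a%:E)%E.
  move=> Da; have /closure_id clE := clg a.
  have : closure (C a) x by apply: clx; exists a.
  rewrite -[X in X -> _]/(closure _ x) => /(closureS (@subIsetr _ _ _)).
  by rewrite -clE.
exists x => // y Ky; case gy : (g y) => [r| |]; rewrite ?leey//.
  by apply: gxD; exists y; rewrite ?gy.
(* If the value [-oo] is attained on [K], every real is in [D], which forces [g x = -oo]. *)
rewrite (@eq_ninfty _ (g x))// => r; apply: gxD.
by exists y; rewrite ?gy ?leNye.
Qed.

Lemma trmx_continuous m n : continuous (@trmx R m n).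
Proof.
move=> M A [Q MQ QA]; exists (fun i j => Q j i).
  by move=> i j; have := MQ j i; rewrite mxE.
by move=> M' QM'; apply: QA => i j; rewrite mxE.
Qed.

Lemma coord_le_norm m (v : 'cV[R]_m) k : `|v k 0| <= `|v|.
Proof.
rewrite [leRHS]/Num.norm/= mx_normrE; apply/bigmax_geP; right.
by exists (k, 0).
Qed.

(** [A] is a closed subset of the image under transposition of a compact box of row vectors. *)
Lemma cV_bounded_closed_compact m (M : R) (A : set 'cV[R]_m) :
  (forall v, A v -> `|v| <= M) -> closed A -> compact A.
Proof.
move=> AM clA.
have cB : compact [set v : 'rV[R]_m | forall i, `[- M, M]%classic (v ord0 i)].
  apply: (@rV_compact _ _ (fun=> `[- M, M]%classic)) => _.
  exact: segment_compact.
have := continuous_compact (continuous_subspaceT (@trmx_continuous _ _)) cB.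
move/subclosed_compact; apply=> // v Av; exists v^T; last by rewrite trmxK.
move=> i /=; rewrite mxE in_itv/= -ler_norml.
exact: le_trans (coord_le_norm _ _) (AM _ Av).
Qed.

(* [Q] plays the role of the squared norm in the definition of strong
   convexity. *)
Lemma strongly_convex_argmin m (G : 'cV[R]_m -> \bar R) (Q : 'cV[R]_m -> R) :
  continuous Q -> (forall a h, Q (a *: h) = a ^+ 2 * Q h) ->
  (forall h, h != 0 -> 0 < Q h) ->
  (forall h, G h != -oo%E) -> (G 0%R < +oo)%E ->
  (forall a : R, closed [set h | (G h <= a%:E)%E]) ->
  (forall a b (ga gb t : R), G a = ga%:E -> G b = gb%:E -> 0 <= t <= 1 ->
    (G (t *: a + (1 - t) *: b)%R <=
       (t * ga + (1 - t) * gb - t * (1 - t) * Q (a - b))%:E)%E) ->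
  exists h, argmin G = [set h].
Proof.
move=> cQ QZ Q0 GNy G0 clG scG.
have [r0 G0E] : exists r0, G 0 = r0%:E.
  by move: (GNy 0) G0; case: (G 0) => // r _ _; exists r.
pose K1 := [set u : 'cV[R]_m | `|u| = 1].
have cK1 : compact K1.
  apply: (@cV_bounded_closed_compact _ 1) => [v /= ->//|].
  exact: (proj1 (continuous_closedP _) (@norm_continuous R _)
    [set x : R | x = 1] (@closed_eq R 1)).
have [M GM] : exists M : R, forall h, (G h <= r0%:E)%E -> `|h| <= M.
  (* The unit sphere is empty only in dimension zero, where every [h] is 0. *)
  have [K10|/set0P K10] := eqVneq K1 set0.
    exists 0 => h _; rewrite normr_le0; apply: contraT => h0.
    suff : K1 (`|h|^-1 *: h) by rewrite K10.
    by rewrite /K1/= normrZ normfV normr_id mulVf ?normr_eq0.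
  have clQ (a : R) : closed [set h | ((Q h)%:E <= a%:E)%E].
    exact: (proj1 (continuous_closedP _) cQ [set x : R | x <= a]
      (@closed_le R a)).
  have [u1 K1u1 u1min] := compact_sublevel_min cK1 K10 clQ.
  have [u2 K1u2 u2min] := compact_sublevel_min cK1 K10 clG.
  have c0 : 0 < Q u1 by apply: Q0; rewrite -normr_eq0 K1u1 oner_eq0.
  have [mu Gmu] : exists mu : R, (mu%:E <= G u2)%E.
    case: (G u2) (GNy u2) => [r| |]// _; first by exists r.
    by exists 0; rewrite leey.
  (* Strong convexity on the segment from 0 to [h], at the unit vector along [h], gives
     [mu <= r0 - (rho - 1) * Q u1] with [rho] the norm of [h]; this radius solves that
     inequality. *)
  exists (1 + `|r0 - mu| / Q u1) => h Ghr0.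
  have [h1|h1] := leP `|h| 1.
    by rewrite (le_trans h1)// lerDl divr_ge0// ltW.
  have h_gt0 : 0 < `|h| by rewrite (lt_trans ltr01).
  have [gh GhE] : exists gh, G h = gh%:E.
    by move: (GNy h) Ghr0; case: (G h) => // r _ _; exists r.
  have K1u : K1 (`|h|^-1 *: h).
    by rewrite /K1/= normrZ normfV normr_id mulVf ?gt_eqF.
  have t01 : 0 <= `|h|^-1 <= 1 by rewrite invr_ge0 normr_ge0/= invf_le1// ltW.
  have := scG _ _ _ _ _ GhE G0E t01.
  rewrite scaler0 addr0 subr0 => /(le_trans (u2min _ K1u))/(le_trans Gmu).
  rewrite lee_fin.
  have : Q u1 <= Q (`|h|^-1 *: h) by have := u1min _ K1u; rewrite lee_fin.
  rewrite QZ; move: Ghr0; rewrite GhE lee_fin => ghr0.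
  set rho := `|h| in h1 h_gt0 t01 *; set Qh := Q h.
  rewrite exprVn ler_pdivlMl ?exprn_gt0// => Qu1h muh.
  have tgh : rho^-1 * gh <= rho^-1 * r0 by rewrite ler_wpM2l// invr_ge0 ltW.
  have : rho^-1 * (1 - rho^-1) * (rho ^+ 2 * Q u1) <= rho^-1 * (1 - rho^-1) * Qh.
    case/andP: t01 => _ t1; rewrite ler_wpM2l// mulr_ge0 ?invr_ge0 ?subr_ge0//.
    exact: ltW.
  have -> : rho^-1 * (1 - rho^-1) * (rho ^+ 2 * Q u1) = (rho - 1) * Q u1.
    by field; rewrite gt_eqF.
  move=> Qle.
  rewrite -lerBlDl ler_pdivlMr//; apply: le_trans (ler_norm _).
  lra.
(* The maximum with 0 keeps the origin in the ball, so the ball is nonempty and its minimum is at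
   most [G 0]. *)
have [h Kh hmin] : exists2 h, `|h| <= Num.max M 0 &
    forall y : 'cV[R]_m, `|y| <= Num.max M 0 -> (G h <= G y)%E.
  apply: (@compact_sublevel_min _ [set h : 'cV[R]_m | `|h| <= Num.max M 0]) => //.
    apply: (@cV_bounded_closed_compact _ (Num.max M 0)) => //.
    exact: (proj1 (continuous_closedP _) (@norm_continuous R _)
      [set x : R | x <= Num.max M 0] (@closed_le R _)).
  by exists 0; rewrite /= normr0 le_max lexx orbT.
have Gh0 : (G h <= G 0%R)%E by apply: hmin; rewrite normr0 le_max lexx orbT.
have hargmin : argmin G h.
  move=> y; have [/GM yM|/ltW] := leP (G y) r0%:E.
    by apply: hmin; rewrite le_max yM.
  by apply: le_trans; rewrite -G0E.
exists h; apply/seteqP; split => [h' h'min|_ ->//]; apply/eqP.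
have [gh GhE] : exists gh, G h = gh%:E.
  move: (GNy h) Gh0; rewrite G0E; case: (G h) => // r _ _; by exists r.
have Gh'E : G h' = gh%:E.
  by apply/eqP; rewrite -GhE eq_le hargmin h'min.
rewrite -subr_eq0; apply: contraT => /Q0 Qgt0.
(* At the midpoint of two distinct minimisers [G] would be smaller by a quarter of [Q (h' - h)]. *)
have t01 : 0 <= (2^-1 : R) <= 1 by lra.
have := scG _ _ _ _ _ Gh'E GhE t01.
move/(le_trans (hargmin _)); rewrite GhE lee_fin; lra.
Qed.

End CompactMinimum.

(** * Continuity of linear and quadratic forms, and finiteness of extended sums *)

Section Continuity.
Context {R : realType}.

Lemma continuous_sumr (X : topologicalType) (I : finType) (F : I -> X -> R) :
  (forall i, continuous (F i)) -> continuous (fun x => \sum_i F i x).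
Proof.
move=> cF; rewrite -fct_sumE.
elim/big_ind: _ => [|f g cf cg|i _]; last exact: cF.
- by move=> x; exact: cst_continuous.
- by move=> x; apply: continuousD; [exact: cf|exact: cg].
Qed.

Lemma continuous_mulr_cst (X : topologicalType) (c : R) (g : X -> R) :
  continuous g -> continuous (fun x => c * g x).
Proof. by move=> cg x; apply: continuousM (cg x); exact: cst_continuous. Qed.

Lemma continuous_addr (X : topologicalType) (g h : X -> R) :
  continuous g -> continuous h -> continuous (fun x => g x + h x).
Proof. by move=> cg ch x; exact: continuousD (cg x) (ch x). Qed.

Lemma continuous_mulmx_coord k m (A : 'M[R]_(k, m)) i :
  continuous (fun h : 'cV[R]_m => (A *m h) i 0).
Proof.
under eq_fun do rewrite mxE.
apply: continuous_sumr => j; apply: continuous_mulr_cst.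
exact: coord_continuous.
Qed.

Lemma continuous_inner_mulmx k m (A A' : 'M[R]_(k, m)) :
  continuous (fun h : 'cV[R]_m => inner (A *m h) (A' *m h)).
Proof.
apply: continuous_sumr => i h.
by apply: continuousM; exact: continuous_mulmx_coord.
Qed.

Lemma continuous_innerr m (g : 'cV[R]_m) : continuous (inner g).
Proof.
apply: continuous_sumr => i; apply: continuous_mulr_cst.
exact: coord_continuous.
Qed.

Lemma finite_esum_terms (I : finType) (F : I -> \bar R) :
  (forall i, F i != -oo%E) -> (\sum_i F i < +oo)%E ->
  exists a : I -> R, forall i, F i = (a i)%:E.
Proof.
move=> FNy sF; exists (fun i => fine (F i)) => i; rewrite fineK//.
rewrite fin_numE FNy/=; apply/eqP => Fi.
move: sF; rewrite (_ : (\sum_i F i)%E = +oo%E) ?ltxx//.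
by apply/esum_eqyP => //; exists i; rewrite mem_index_enum.
Qed.

(** An exact identity for quadratic forms, from which the strong convexity of the step objective
    comes. *)
Lemma posdef_convex_comb m (B : 'M[R]_m) (a b : 'cV[R]_m) (t : R) :
  sym_posdef B ->
  mxnorm B (t *: a + (1 - t) *: b) ^+ 2 =
  t * mxnorm B a ^+ 2 + (1 - t) * mxnorm B b ^+ 2
    - t * (1 - t) * mxnorm B (a - b) ^+ 2.
Proof.
move=> hB; rewrite !mxnorm_sqr// !mulmxDr mulmxN -!scalemxAr.
rewrite !(innerDl, innerDr, innerNl, innerNr, innerZl, innerZr).
by rewrite (posdef_innerC hB b a); ring.
Qed.

End Continuity.

(** * The step objective, its minimiser and partial steps *)

Section Step.
Context {R : realType} {n : nat} {Ns : 'I_n -> nat}.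
Local Notation N := (\sum_i Ns i)%N.
Context (s : 'S_N) (B : forall i, 'M[R]_(Ns i)) (f : 'cV[R]_N -> R).
Context (beta : R) (w : 'I_n -> R) (Om : 'cV[R]_N -> \bar R).
Hypothesis hB : forall i, sym_posdef (B i).
Hypothesis beta0 : 0 < beta.
Hypothesis w0 : forall i, 0 < w i.
Local Notation Q := (fun h => beta / 2 * wnorm s B w h ^+ 2).

Let w_ge0 i : 0 <= w i. Proof. exact: ltW. Qed.

Lemma wnorm_sqr_gt0 h : h != 0 -> 0 < wnorm s B w h ^+ 2.
Proof.
move=> h0; rewrite lt_neqAle sqr_ge0 andbT eq_sym.
apply: contra_neq h0; rewrite wnorm_sqr// => /psumr_eq0P h0.
apply: (block_inj (s := s)) => i; rewrite block0.
apply: (mxnorm_eq0 (hB i)); apply/eqP; rewrite -sqrf_eq0.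
rewrite -(mulrI_eq0 _ (lregP (lt0r_neq0 (w0 i)))) h0// => j _.
by rewrite mulr_ge0// sqr_ge0.
Qed.

Lemma wnorm_sqrZ a h : wnorm s B w (a *: h) ^+ 2 = a ^+ 2 * wnorm s B w h ^+ 2.
Proof.
rewrite !wnorm_sqr// mulr_sumr; apply: eq_bigr => i _.
by rewrite blockZ mxnormZ exprMn real_normK ?num_real// mulrCA.
Qed.

Lemma wnorm_sqr_continuous : continuous (fun h => wnorm s B w h ^+ 2).
Proof.
rewrite (_ : (fun h => _) = fun h =>
    \sum_i w i * inner ((B i *m (U_ s i)^T) *m h) ((U_ s i)^T *m h)).
  apply: continuous_sumr => i; apply: continuous_mulr_cst.
  exact: continuous_inner_mulmx.
apply/funext => h; rewrite wnorm_sqr//; apply: eq_bigr => i _.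
by rewrite mxnorm_sqr// -mulmxA.
Qed.

Lemma wnorm_sqr_convex_comb a b t :
  wnorm s B w (t *: a + (1 - t) *: b) ^+ 2 =
  t * wnorm s B w a ^+ 2 + (1 - t) * wnorm s B w b ^+ 2
    - t * (1 - t) * wnorm s B w (a - b) ^+ 2.
Proof.
rewrite !wnorm_sqr// !mulr_sumr -big_split -sumrB/=.
apply: eq_bigr => i _; rewrite -[- b]scaleN1r !blockD !blockZ scaleN1r.
by rewrite posdef_convex_comb//; ring.
Qed.

Lemma step_objective_argmin x :
  proper_fun Om -> closed_fun Om -> convex_efun Om -> (Om x < +oo)%E ->
  exists h, argmin (step_objective s B f Om beta w x) = [set h].
Proof.
move=> [OmNy _] clOm cvOm Omx.
pose q h := f x + inner (grad f x) h + beta / 2 * wnorm s B w h ^+ 2.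
have qE a b t : q (t *: a + (1 - t) *: b) =
    t * q a + (1 - t) * q b - t * (1 - t) * (beta / 2 * wnorm s B w (a - b) ^+ 2).
  rewrite /q wnorm_sqr_convex_comb innerDr !innerZr.
  by ring.
(* With the finite part [q] moved to the right, closed sublevel sets come from the closed epigraph
   of [Om], and strong convexity from the convexity of [Om] and [qE]. *)
have Gle h (a : R) : (step_objective s B f Om beta w x h <= a%:E)%E =
    (Om (x + h)%R <= (a - q h)%:E)%E.
  by rewrite /step_objective EFinB leeBrDl.
have cq : continuous q.
  apply: continuous_addr.
    by apply: continuous_addr; [exact: cst_continuous|exact: continuous_innerr].
  exact/continuous_mulr_cst/wnorm_sqr_continuous.
apply: (@strongly_convex_argmin _ _ _ Q).
- exact/continuous_mulr_cst/wnorm_sqr_continuous.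
- by move=> a h; rewrite wnorm_sqrZ mulrCA.
- by move=> h h0; rewrite mulr_gt0 ?divr_gt0 ?wnorm_sqr_gt0.
- by move=> h; rewrite /step_objective; case: (Om _) (OmNy (x + h)).
- rewrite /step_objective addr0; case: (Om x) Omx => //= r _.
  by rewrite -EFinD ltry.
- move=> a; rewrite (_ : [set h | _] = (fun h => (x + h, a - q h)) @^-1`
      [set p : 'cV[R]_N * R | (Om p.1 <= p.2%:E)%E]); last first.
    by apply/funext => h; rewrite /= Gle.
  apply: (proj1 (continuous_closedP _)) clOm => h.
  have cx : x + h' @[h' --> h] --> x + h.
    apply: (@cvgD _ _ _ (nbhs h) _ (cst x) id); first exact: cst_continuous.
    exact: cvg_id.
  have caq : a - q h' @[h' --> h] --> a - q h.
    by apply: (@cvgB _ _ _ (nbhs h) _ (cst a) q);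
      [exact: cst_continuous|exact: cq].
  exact: cvg_pair cx caq.
- move=> a b ga gb t Ga Gb t01.
  have Oma : (Om (x + a)%R <= (ga - q a)%:E)%E by rewrite -Gle Ga.
  have Omb : (Om (x + b)%R <= (gb - q b)%:E)%E by rewrite -Gle Gb.
  rewrite Gle.
  have -> : x + (t *: a + (1 - t) *: b) = t *: (x + a) + (1 - t) *: (x + b).
    by rewrite !scalerDr addrACA -scalerDl subrKC scale1r.
  apply: (le_trans (cvOm _ _ _ t01)).
  case/andP: t01 => t0 t1.
  apply: (@le_trans _ _ (t * (ga - q a) + (1 - t) * (gb - q b))%:E).
    rewrite [leRHS]EFinD !EFinM.
    by apply: leeD; apply: lee_wpmul2l => //; rewrite lee_fin// subr_ge0.
  rewrite lee_fin le_eqVlt; apply/orP; left; apply/eqP.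
  by rewrite qE; ring.
Qed.

Lemma inner_add_wnorm_blocks g h :
  inner g h + beta / 2 * wnorm s B w h ^+ 2 =
  \sum_i (inner (block s i g) (block s i h) +
    beta / 2 * (w i * mxnorm (B i) (block s i h) ^+ 2)).
Proof.
by rewrite wnorm_sqr// (inner_blocks s) mulr_sumr -big_split.
Qed.

Lemma inner_add_wnorm_restr g A h :
  inner g (restr s A h) + beta / 2 * wnorm s B w (restr s A h) ^+ 2 =
  \sum_(i in A) (inner (block s i g) (block s i h) +
    beta / 2 * (w i * mxnorm (B i) (block s i h) ^+ 2)).
Proof.
rewrite inner_add_wnorm_blocks [RHS]big_mkcond/=.
apply: eq_bigr => i _; rewrite block_restr; case: ifP => // _.
by rewrite inner0r mxnorm_sqr// inner0r !mulr0 addr0.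
Qed.

(* Compare [h] with the competitor [h_[~: A]]: block separability turns
   minimality into a bound on the blocks in [A] only. *)
Lemma restr_step_le x h A :
  block_separable s Om -> (Om x < +oo)%E ->
  argmin (step_objective s B f Om beta w x) h ->
  (step_objective s B f Om beta w x (restr s A h) <= (f x)%:E + Om x)%E.
Proof.
move=> [Omi [OmiNy _ _ OmE]] Omx hmin.
have OmNy y : Om y != -oo%E.
  rewrite OmE esum_eqNy negb_exists; apply/forallP => i.
  by rewrite negb_and OmiNy orbT.
have [b bE] : exists b : 'I_n -> R, forall i, Omi i (block s i x) = (b i)%:E.
  by apply: finite_esum_terms => //; rewrite -OmE.
have [a aE] : exists a : 'I_n -> R,
    forall i, Omi i (block s i (x + h)) = (a i)%:E.
  apply: finite_esum_terms => //; rewrite -OmE.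
  (* The zero step has a finite objective, hence so does the minimiser. *)
  have := hmin 0; rewrite /step_objective addr0 ltey.
  case: (Om x) (OmNy x) Omx => // r _ _; apply: contraTneq => ->.
  by rewrite addey// -EFinD leye_eq.
have OmA A' : Om (x + restr s A' h) =
    (\sum_(i in A') a i + \sum_(i in ~: A') b i)%:E.
  rewrite OmE (eq_bigr (fun i => (if i \in A' then a i else b i)%:E)); last first.
    move=> i _; rewrite blockD block_restr; case: ifP => _.
      by rewrite -blockD aE.
    by rewrite addr0 bE.
  rewrite sumEFin; congr (_%:E); rewrite (bigID (mem A'))/=; congr (_ + _).
    by apply: eq_bigr => i ->.
  by apply: eq_big => i; rewrite ?inE// => /negbTE ->.
have OmxE : Om x = (\sum_(i in A) b i + \sum_(i in ~: A) b i)%:E.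
  rewrite OmE (eq_bigr _ (fun i _ => bE i)) sumEFin (bigID (mem A))/=.
  by congr ((_ + _)%:E); apply: eq_bigl => i; rewrite inE.
have OmxhE : Om (x + h) = (\sum_(i in A) a i + \sum_(i in ~: A) a i)%:E.
  rewrite OmE (eq_bigr _ (fun i _ => aE i)) sumEFin (bigID (mem A))/=.
  by congr ((_ + _)%:E); apply: eq_bigl => i; rewrite inE.
(* This competitor agrees with [h] on the blocks outside [A], so their contributions cancel and only
   those of [A] are compared. *)
have := hmin (restr s (~: A) h).
rewrite /step_objective !OmA OmxE OmxhE finset.setCK -!EFinD !lee_fin -!addrA.
rewrite !lerD2l !addrA !inner_add_wnorm_restr inner_add_wnorm_blocks.
rewrite (bigID (mem A))/= [X in _ + X + _ + _](eq_bigl (fun i => i \in ~: A)).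
  set u := \sum_(i in A) _; lra.
by move=> i; rewrite inE.
Qed.

End Step.

(** * Almost sure decrease of the composite objective *)

Section Monotonic.
Context {R : realType} {n : nat} {Ns : 'I_n -> nat}.
Local Notation N := (\sum_i Ns i)%N.
Context (s : 'S_N) (B : forall i, 'M[R]_(Ns i)) (f : 'cV[R]_N -> R).
Context (omega : nat) (L : 'I_n -> R).
Context {d : measure_display} {T : measurableType d} (P : probability T R).
Context (S : T -> {set 'I_n}).

Lemma monotonic_minn (tau : nat) :
  (forall i, sym_posdef (B i)) -> partially_separable s omega f ->
  (forall i, 0 < L i) -> block_lipschitz s B f L -> sampling S ->
  0 < (minn omega tau)%:R :> R -> P [set t | #|S t| = tau] = 1%E ->
  monotonic P S s B f (minn omega tau)%:R L.
Proof.
move=> hB hf hL0 hL hS beta0 htau Om prOm clOm cvOm sepOm F x Fx.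
have Omx : (Om x < +oo)%E.
  have : ((f x)%:E + Om x < +oo)%E by [].
  by rewrite !ltey; apply: contraNneq => ->; rewrite addey.
have [h hE] := step_objective_argmin s f hB beta0 hL0 prOm clOm cvOm Omx.
exists h; split=> //.
have hmin : argmin (step_objective s B f Om (minn omega tau)%:R L x) h.
  by rewrite hE.
have := ae_of_constant_card hS htau.
apply: filterS => t St.
(* As [S t] has [tau] elements, the factor in [sampled_descent] is exactly [beta], so the step
   objective at [restr s (S t) h] dominates [F]. *)
apply: le_trans (restr_step_le hB hL0 (S t) sepOm Omx hmin).
rewrite /F /step_objective leeD2r// lee_fin -addrA inner_add_wnorm_restr//.
by rewrite -St; exact: sampled_descent.
Qed.

End Monotonic.

Theorem theorem12 (R : realType) (n : nat) (Ns : 'I_n -> nat)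
    (s : 'S_(\sum_i Ns i)) (B : forall i, 'M[R]_(Ns i))
    (f : 'cV[R]_(\sum_i Ns i) -> R) (omega : nat) (L : 'I_n -> R)
    (d : measure_display) (T : measurableType d) (P : probability T R)
    (S : T -> {set 'I_n})
    (hNs : forall i, (1 <= Ns i)%N)
    (hB : forall i, sym_posdef (B i))
    (homega : (1 <= omega <= n)%N)
    (hf : partially_separable s omega f)
    (hL0 : forall i, 0 < L i)
    (hL : block_lipschitz s B f L)
    (hS : sampling S)
    (hproper : proper_sampling P S)
    (hunif : uniform_sampling P S) :
  ESO P S s B f 1 (fun i => nu P S omega i * L i) /\
  (forall tau : nat, P [set t | #|S t| = tau] = 1%E ->
     ESO P S s B f (minn omega tau)%:R L /\
     monotonic P S s B f (minn omega tau)%:R L).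
Proof.
split; first exact: ESO_nu.
move=> tau htau; split; first exact: ESO_minn.
apply: monotonic_minn => //; exact: minn_tau_gt0 htau.
Qed.
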